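(* Let $$\psi=\left(1473+\sqrt{13712905}\right)^{1/3},\qquad \phi=\sqrt{-50\psi+481+11300\,\psi^{-1}},$$ $$t_6=\frac{9+\phi+\sqrt{50\psi+962-11300\,\psi^{-1}+47258\,\phi^{-1}}}{100},$$ and $p_6(t)=(5-4t)(1+2t+3t^2+4t^3+5t^4)$. Then the maximal real number $\lambda>0$ such that $$\sum_{i=1}^6\frac{1}{x_i}\ \ge\ \frac{\lambda}{1+6^{4}(\lambda-36)\prod_{i=1}^6 x_i}$$ holds for all real $x_1,\ldots,x_6>0$ with $\sum_{i=1}^6 x_i=1$ is $$\lambda_6=\frac{6^2}{1-\frac{5}{p_6(t_6)}}.$$
   Context: All roots are real roots. (Numerically $\lambda_6\approx 52.358913$.) *)

(* Defs.v *)
From mathcomp Require Import all_boot all_order all_algebra.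
From mathcomp Require Import all_classical all_reals all_analysis.

Set Implicit Arguments.
Unset Strict Implicit.
Unset Printing Implicit Defensive.

Import Order.TTheory GRing.Theory Num.Theory.

Local Open Scope ring_scope.

(* Bare numerals of [ring_scope] are unary; the explicit [%:R] keeps the
   constants above 5000 in decimal form. *)
Definition psi (R : realType) : R := (1473 + Num.sqrt 13712905%:R) `^ (1 / 3).

Definition phi (R : realType) : R :=
  Num.sqrt (- 50 * psi R + 481 + 11300%:R * (psi R)^-1).

Definition t6 (R : realType) : R :=
  (9 + phi R
     + Num.sqrt (50 * psi R + 962 - 11300%:R * (psi R)^-1
                 + 47258%:R * (phi R)^-1))
  / 100.

Definition p6 (R : realType) (t : R) : R :=
  (5 - 4 * t) * (1 + 2 * t + 3 * t ^+ 2 + 4 * t ^+ 3 + 5 * t ^+ 4).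

Definition lambda6 (R : realType) : R := 6 ^+ 2 / (1 - 5 / p6 (t6 R)).

(* The division by the denominator below is a genuine one: for positive [x i]
   of sum 1 the product lies in ]0, 6 ^- 6], so when [0 < lam] the denominator
   is at least [Num.min 1 (lam / 36)], which is positive. *)
Definition admissible (R : realType) (lam : R) : Prop :=
  0 < lam /\
  forall x : 'I_6 -> R,
    (forall i, 0 < x i) -> \sum_(i < 6) x i = 1 ->
    \sum_(i < 6) (1 / x i)
      >= lam / (1 + 6 ^+ 4 * (lam - 36) * \prod_(i < 6) x i).

(* Main.v *)
Require Import Defs.
From mathcomp Require Import all_boot all_order all_algebra.
From mathcomp Require Import all_classical all_reals all_analysis.
From mathcomp Require Import ring lra.

Import Order.TTheory GRing.Theory Num.Theory.
Import numFieldTopology.Exports.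

Local Open Scope classical_set_scope.
Local Open Scope ring_scope.

(** Write S for the sum of the 1 / x_i and P for the product of the x_i. After
    clearing the positive denominator, lam is admissible iff
    S * (1 + 6 ^ 4 * (lam - 36) * P) >= lam on the simplex.

    With the sum and the product of the x_i held fixed, S is smallest when all
    the variables but the largest one are equal ([equal_variables]). For
    lam > 36 the left-hand side is an increasing function of S, so only the
    points (t, t, t, t, t, z) with 5 t + z = 1 matter. There, with u = 6 t, the
    gap between the two sides is a positive multiple of
      (1 - u) ^ 2 * (36 * p6 u - lam * (p6 u - 5))
    ([gap_equal_variables]), and p6 u > 5. Hence the best constant is
    36 * M / (M - 5) = 36 / (1 - 5 / M), M being the maximum of p6 over u > 0;
    a larger lam fails at the point where this maximum is attained.

    The derivative of p6 is - 2 times the quartic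
    50 t ^ 4 - 18 t ^ 3 - 12 t ^ 2 - 7 t - 3. Its positive root is t6: the
    number v = psi - 226 / psi is the Cardano solution of
    v ^ 3 + 678 v = 2946 ([cardano]), and this cubic is the resolvent that splits
    the quartic into two quadratic factors ([ferrari]). Moreover
    p6 t6 - p6 t = (t - t6) ^ 2 * q t, where q is a cubic with nonnegative
    coefficients since t6 > 4 / 5, which makes t6 a global maximum on the
    positive half-line ([p6_max]). *)

(** * Reduction to five equal variables *)

(** Three positive reals a < b <= c can be moved to (t, t, z) without changing
    their sum s or their product, in such a way that the sum of inverses drops;
    no coordinate leaves the half-line above a. Here t solves
    t ^ 2 * (s - 2 t) = a b c between a and the midpoint m of a and b: replacing
    (a, b) by (m, m) increases the product strictly, while at t = a the
    left-hand side is too small. Comparing the cubic with roots a, b, c and the one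
    with roots t, t, z, which differ only in their linear coefficient, gives the
    drop: the difference of the cubics at t is (t - a) (t - b) (t - c) > 0. *)
Lemma merge_triple (R : rcfType) (a b c : R) : 0 < a -> a < b -> b <= c ->
  exists t z : R, [/\ a <= t, a <= z, t + t + z = a + b + c,
    t * t * z = a * b * c & t^-1 + t^-1 + z^-1 < a^-1 + b^-1 + c^-1].
Proof.
move=> a0 ab bc; pose s := a + b + c; pose m := (a + b) / 2.
pose q : {poly R} := 'X ^+ 2 * (s%:P - 2%:P * 'X) - (a * b * c)%:P.
have qE t : q.[t] = t ^+ 2 * (s - 2 * t) - a * b * c by rewrite /q !hornerE.
have am : a <= m by rewrite /m; lra.
have qa : q.[a] <= 0.
  have -> : q.[a] = - (a * ((b - a) * (c - a))) by rewrite qE /s; ring.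
  by rewrite oppr_le0 !mulr_ge0 // ?subr_ge0; lra.
have qm : 0 < q.[m].
  have -> : q.[m] = c * (b - a) ^+ 2 / 4 by rewrite qE /s /m; field.
  by rewrite divr_gt0 // mulr_gt0 // ?exprn_gt0 ?subr_gt0 //; lra.
have [] := @poly_ivt R q a m am; first by rewrite qa ltW.
move=> t /andP[at_ tm] /eqP; rewrite qE => qt.
have ne u : q.[u] != 0 -> t != u by apply: contra => /eqP <-; rewrite qE qt.
have tm' : t < m by rewrite lt_neqAle tm ne // gt_eqF.
have at' : a < t.
  rewrite lt_neqAle at_ eq_sym ne //.
  have -> : q.[a] = - (a * ((b - a) * (c - a))) by rewrite qE /s; ring.
  by rewrite oppr_eq0 gt_eqF // !mulr_gt0 // subr_gt0; lra.
have mb : m < b by rewrite /m; lra.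
have cz : c < s - 2 * t by move: tm'; rewrite /s /m; lra.
have prodE : t * t * (s - 2 * t) = a * b * c by rewrite -[LHS]subr0 -qt; ring.
exists t, (s - 2 * t); split=> //; [lra| by rewrite /s; ring |].
have [t0 z0 b0 c0] : [/\ 0 < t, 0 < s - 2 * t, 0 < b & 0 < c] by split; lra.
have -> : t^-1 + t^-1 + (s - 2 * t)^-1 =
    (2 * t * (s - 2 * t) + t ^+ 2) / (a * b * c).
  by rewrite -prodE; field; rewrite !gt_eqF.
have -> : a^-1 + b^-1 + c^-1 = (a * b + a * c + b * c) / (a * b * c).
  by field; rewrite !gt_eqF.
rewrite ltr_pM2r ?invr_gt0 ?mulr_gt0 // -subr_gt0 -(pmulr_rgt0 _ t0).
(* Evaluate at t the cubics with roots a, b, c and t, t, z; the constant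
   coefficients agree by [prodE]. *)
have -> : t * (a * b + a * c + b * c - (2 * t * (s - 2 * t) + t ^+ 2)) =
    (t - a) * ((b - t) * (c - t)).
  have : t * t * (s - 2 * t) - a * b * c = 0 by rewrite prodE subrr.
  by rewrite /s => e; rewrite -[LHS]addr0 -e; ring.
by rewrite !mulr_gt0 // subr_gt0; lra.
Qed.

Lemma bigD3 (T : Type) (idx : T) (op : Monoid.com_law idx) (I : finType)
    (i j k : I) (F : I -> T) : j != i -> k != i -> k != j ->
  \big[op/idx]_l F l =
    op (op (op (F i) (F j)) (F k))
       (\big[op/idx]_(l | (l != i) && (l != j) && (l != k)) F l).
Proof.
move=> ji ki kj; rewrite (bigD1 i) //= (bigD1 j) ?ji //= (bigD1 k) ?ki ?kj //=.
by rewrite !Monoid.mulmA.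
Qed.

(** The sum of inverses attains its minimum on the compact set of the vectors that
    have the same sum and product as x and whose coordinates are at least the
    smallest x_i. At a minimum, [merge_triple] forbids a triple a < b <= c, so
    every coordinate other than a largest one equals the smallest one. *)
Lemma equal_variables (R : realType) (n : nat) (x : 'I_n.+1 -> R) :
  (forall i, 0 < x i) ->
  exists t z : R, [/\ 0 < t, t <= z, n%:R * t + z = \sum_i x i,
    t ^+ n * z = \prod_i x i & n%:R / t + 1 / z <= \sum_i 1 / x i].
Proof.
move=> x0; pose s := \sum_i x i; pose p := \prod_i x i.
have [e e0 ex] : exists2 e, 0 < e & forall i, e <= x i.
  case: (@arg_minP _ _ _ (@ord0 n) xpredT x isT) => i _ xi.
  by exists (x i) => // j; exact: xi.
pose K0 := [set v : 'rV[R]_n.+1 | forall i, v ord0 i \in `[e, s]].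
pose K := K0 `&` [set v : 'rV[R]_n.+1 | \sum_i v ord0 i = s]
             `&` [set v : 'rV[R]_n.+1 | \prod_i v ord0 i = p].
have Kx : K (\row_i x i).
  split; [split|]; rewrite /K0 /=; last 2 first.
  - by apply: eq_bigr => i _; rewrite mxE.
  - by apply: eq_bigr => i _; rewrite mxE.
  - move=> i; rewrite mxE in_itv /= ex /= /s (bigD1 i) //= lerDl.
    by apply: sumr_ge0 => j _; exact: ltW.
have cK : compact K.
  have cK0 : compact K0.
    apply: (@rV_compact _ _ (fun=> `[e, s]%classic)) => _.
    exact: segment_compact.
  rewrite /K -setIA; apply: (subclosed_compact _ cK0); last by apply: subIsetl.
  apply: closedI; first by apply: compact_closed => //; exact: norm_hausdorff.
  apply: closedI.
    apply: (@closed_comp _ _ (fun v : 'rV[R]_n.+1 => \sum_i v ord0 i) [set s]);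
      last exact: closed_eq.
    move=> v _; apply: continuous_big; first exact: add_continuous.
    by move=> i _; exact: coord_continuous.
  apply: (@closed_comp _ _ (fun v : 'rV[R]_n.+1 => \prod_i v ord0 i) [set p]);
    last exact: closed_eq.
  move=> v _; apply: continuous_big; first exact: mul_continuous.
  by move=> i _; exact: coord_continuous.
pose T (v : 'rV[R]_n.+1) := \sum_i (v ord0 i)^-1.
have K_gt0 v i : K v -> 0 < v ord0 i.
  move=> [[/(_ i)]]; rewrite in_itv /= => /andP[ev _] _ _.
  exact: lt_le_trans ev.
have cT : {within K, continuous T}.
  apply: continuous_in_subspaceT => v; rewrite inE => Kv.
  apply: (@cvg_big _ _ _ _ _ add_continuous _ (nbhs v)) => i _.
  apply: cvgV; first by rewrite gt_eqF // K_gt0.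
  exact: coord_continuous.
(* [v] is a minimiser, i and k are the places of its extreme coordinates. *)
have [v] := EVT_min_rV (ex_intro _ _ Kx) cK cT; rewrite inE => Kv vmin.
case: (@arg_minP _ _ _ (@ord0 n) xpredT (v ord0) isT) => i _ vi.
case: (@arg_maxP _ _ _ (@ord0 n) xpredT (v ord0) isT) => k _ vk.
have vE j : j != k -> v ord0 j = v ord0 i.
  move=> jk; apply/eqP; rewrite eq_le vi // andbT leNgt; apply/negP => ij.
  have nij : j != i by apply: contraTneq ij => ->; rewrite ltxx.
  have nik : k != i.
    by apply: contraTneq (lt_le_trans ij (vk j isT)) => ->; rewrite ltxx.
  have nkj : k != j by rewrite eq_sym.
  have [t [z [it iz sE pE Tlt]]] :=
    merge_triple _ _ _ _ (K_gt0 v i Kv) ij (vk j isT).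
  (* [w] is [v] with the triple at i, j, k replaced by (t, t, z). *)
  pose w := \row_l (if l == k then z else
                    if (l == i) || (l == j) then t else v ord0 l).
  have wi : w ord0 i = t by rewrite mxE eqxx eq_sym (negPf nik).
  have wj : w ord0 j = t by rewrite mxE eqxx orbT (negPf jk).
  have wk : w ord0 k = z by rewrite mxE eqxx.
  have wE l : (l != i) && (l != j) && (l != k) -> w ord0 l = v ord0 l.
    by move=> /andP[/andP[li lj] lk]; rewrite mxE (negPf li) (negPf lj) (negPf lk).
  have Kw : K w.
    case: Kv => [[Kv0 Kvs] Kvp]; have ei : e <= v ord0 i.
      by have := Kv0 i; rewrite in_itv => /andP[].
    have sw : \sum_l w ord0 l = s.
      rewrite -Kvs !(bigD3 _ _ _ _ i j k) //= wi wj wk sE.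
      by congr (_ + _); apply: eq_bigr => l /wE.
    have pw : \prod_l w ord0 l = p.
      rewrite -Kvp !(bigD3 _ _ _ _ i j k) //= wi wj wk pE.
      by congr (_ * _); apply: eq_bigr => l /wE.
    have we l : e <= w ord0 l.
      rewrite mxE; case: ifP => _; first exact: le_trans iz.
      case: ifP => _; first exact: le_trans it.
      by have := Kv0 l; rewrite in_itv => /andP[].
    split; [split|] => // l; rewrite in_itv /= we /= -sw (bigD1 l) //= lerDl.
    by apply: sumr_ge0 => m _; exact/ltW/(lt_le_trans e0).
  have := vmin w; rewrite inE => /(_ Kw); rewrite leNgt => /negP; apply.
  rewrite /T !(bigD3 _ _ _ _ i j k) //= wi wj wk.
  rewrite (eq_bigr (fun l => (v ord0 l)^-1)); last by move=> l /wE ->.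
  by rewrite ltrD2r.
exists (v ord0 i), (v ord0 k).
have sumE (F : R -> R) :
    \sum_l F (v ord0 l) = n%:R * F (v ord0 i) + F (v ord0 k).
  rewrite (bigD1 k) //= addrC; congr (_ + _).
  rewrite (eq_bigr (fun=> F (v ord0 i))); last by move=> l /vE ->.
  by rewrite sumr_const cardC1 card_ord mulr_natl.
split; [exact: K_gt0|exact: vi| | |].
- by rewrite -(sumE id); case: Kv => [[]].
- case: Kv => _ /= vp; rewrite -/p -vp (bigD1 k) //= mulrC; congr (_ * _).
  rewrite (eq_bigr (fun=> v ord0 i)); last by move=> l /vE ->.
  by rewrite prodr_const cardC1 card_ord.
- rewrite div1r -(sumE GRing.inv).
  have := vmin (\row_i x i); rewrite inE => /(_ Kx) /le_trans; apply.
  by rewrite /T; apply: ler_sum => l _; rewrite mxE div1r.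
Qed.

(** * The root t6 of the derivative of p6 *)

Lemma psi_gt0 (R : realType) : 0 < psi R.
Proof.
rewrite /psi; have := sqrtr_ge0 (13712905%:R : R).
move: (Num.sqrt _) => d d0; apply: powR_gt0; lra.
Qed.

Lemma psi_cubed (R : realType) : psi R ^+ 3 = 1473 + Num.sqrt 13712905%:R.
Proof.
have := ltW (psi_gt0 R).
rewrite /psi; have := sqrtr_ge0 (13712905%:R : R).
move: (Num.sqrt _) => d d0 p0; rewrite -powR_mulrn // -powRrM.
have -> : 1 / 3 * 3%:R = 1 :> R by field.
have d1 : 0 <= 1473 + d by lra.
exact: powRr1 d1.
Qed.

(** psi ^ 3 is a root of X ^ 2 - 2946 X - 226 ^ 3, since
    13712905 - 1473 ^ 2 = 226 ^ 3 = 11543176. Hence psi and - 226 / psi,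
    whose product is - 226, have cubes of sum 2946; expanding the cube of
    v = psi + (- 226 / psi) gives the equation. *)
Lemma cardano (R : realType) (v := psi R - 226 / psi R) :
  v ^+ 3 + 678 * v = 2946.
Proof.
have p0 : psi R != 0 by rewrite gt_eqF ?psi_gt0.
have d2 : Num.sqrt 13712905%:R ^+ 2 = 13712905%:R :> R by rewrite sqr_sqrtr.
have sextic : (psi R ^+ 3) ^+ 2 - 2946 * psi R ^+ 3 = 11543176%:R.
  rewrite psi_cubed; move: (Num.sqrt _) d2 => d d2.
  have -> : (1473 + d) ^+ 2 - 2946 * (1473 + d) = d ^+ 2 - 2169729%:R by ring.
  by rewrite d2; ring.
have -> : v ^+ 3 + 678 * v =
    2946 + ((psi R ^+ 3) ^+ 2 - 2946 * psi R ^+ 3 - 11543176%:R) / psi R ^+ 3.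
  by rewrite /v; field.
by rewrite sextic; ring.
Qed.

Lemma cardano_bounds (R : realFieldType) (v : R) :
  v ^+ 3 + 678 * v = 2946 -> 4 < v < 5.
Proof. by move=> h; apply/andP; split; nra. Qed.

(** In terms of w = 100 t - 9 the quartic, multiplied by 2000000, is the depressed
    quartic w ^ 4 - 2886 w ^ 2 - 189032 w - 7474083. When f ^ 2 solves its resolvent
    cubic, which the substitution f ^ 2 = 481 - 50 v turns into the equation
    of v, it is the difference of squares
      (w ^ 2 + B) ^ 2 - (2 f w + 47258 / f) ^ 2   with B = 2 f ^ 2 - 1443,
    and w = f + d is a root of one of the two factors. *)
Lemma ferrari (R : realFieldType) (v f d : R) :
  v ^+ 3 + 678 * v = 2946 -> f != 0 -> f ^+ 2 = 481 - 50 * v ->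
  d ^+ 2 = 962 + 50 * v + 47258%:R / f ->
  let t := (9 + f + d) / 100 in
  50 * t ^+ 4 - 18 * t ^+ 3 - 12 * t ^+ 2 - 7 * t - 3 = 0.
Proof.
move=> hv f0 hf hd t; pose w := f + d; pose B := - 481 - 100 * v.
(* w is a root of the factor w ^ 2 - 2 f w + B - 47258 / f. *)
have h1 : w ^+ 2 + B = 2 * f * w + 47258%:R / f.
  have -> : w ^+ 2 + B = 2 * f * w + d ^+ 2 - f ^+ 2 + B by rewrite /w; ring.
  by rewrite hd hf /B; ring.
(* The resolvent cubic: it makes the constant terms match. *)
have h2 : (47258%:R / f) ^+ 2 = B ^+ 2 + 7474083%:R.
  rewrite expr_div_n hf.
  have A0 : 481 - 50 * v != 0 by rewrite -hf expf_neq0.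
  apply: (mulIf A0); rewrite (divfK A0).
  have -> : (B ^+ 2 + 7474083%:R) * (481 - 50 * v) =
      47258%:R ^+ 2 - 500000%:R * (v ^+ 3 + 678 * v - 2946) by rewrite /B; ring.
  by rewrite hv; ring.
have h3 : w ^+ 4 - 2886 * w ^+ 2 - 189032%:R * w - 7474083%:R = 0.
  have -> : w ^+ 4 - 2886 * w ^+ 2 - 189032%:R * w - 7474083%:R =
      (w ^+ 2 + B) ^+ 2 - (2 * f * w + 47258%:R / f) ^+ 2
      + ((47258%:R / f) ^+ 2 - (B ^+ 2 + 7474083%:R))
      + 4 * w ^+ 2 * (f ^+ 2 - (481 - 50 * v)).
    by rewrite /B; field.
  by rewrite h1 h2 hf; ring.
have -> : 50 * t ^+ 4 - 18 * t ^+ 3 - 12 * t ^+ 2 - 7 * t - 3 =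
    (w ^+ 4 - 2886 * w ^+ 2 - 189032%:R * w - 7474083%:R) / 2000000%:R.
  by rewrite /t /w; field.
by rewrite h3 mul0r.
Qed.

Lemma t6_spec (R : realType) (t := t6 R) :
  4 / 5 < t < 1 /\ 50 * t ^+ 4 - 18 * t ^+ 3 - 12 * t ^+ 2 - 7 * t - 3 = 0.
Proof.
have := cardano R; set v := psi R - _ => hv.
have /andP[v4 v5] := cardano_bounds _ _ hv.
have phiE : phi R = Num.sqrt (481 - 50 * v).
  by rewrite /phi; congr Num.sqrt; rewrite /v; ring.
have hf : phi R ^+ 2 = 481 - 50 * v by rewrite phiE; apply: sqr_sqrtr; lra.
have f_ge0 : 0 <= phi R by exact: sqrtr_ge0.
(* 4 < v < 5 gives 231 < phi ^ 2 < 281. *)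
have f15 : 15 < phi R by nra.
have f17 : phi R < 17 by nra.
have f0 : phi R != 0 by rewrite gt_eqF //; lra.
pose D := 962 + 50 * v + 47258%:R / phi R.
have tE : t = (9 + phi R + Num.sqrt D) / 100.
  rewrite /t /t6; congr ((_ + Num.sqrt _) / _); rewrite /D /v; ring.
have lo : 2779 < 47258%:R / phi R by rewrite ltr_pdivlMr; lra.
have hi : 47258%:R / phi R < 3151 by rewrite ltr_pdivrMr; lra.
have D0 : 0 <= D by rewrite /D; lra.
have hd : Num.sqrt D ^+ 2 = D by exact: sqr_sqrtr.
have d0 := sqrtr_ge0 D.
split; last by rewrite tE; exact: ferrari hv f0 hf hd.
have d62 : 62 < Num.sqrt D by move: hd; rewrite {2}/D; nra.
have d67 : Num.sqrt D < 67 by move: hd; rewrite {2}/D; nra.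
by rewrite tE; lra.
Qed.

(** * The polynomial p6 *)

Lemma p6_gt5 (R : realType) (t : R) : 0 < t -> t < 6 / 5 -> 5 < p6 t.
Proof.
move=> t0 t1; rewrite -subr_gt0.
have -> : p6 t - 5 = t * (6 - 5 * t) * (1 + 2 * t + 3 * t ^+ 2 + 4 * t ^+ 3).
  by rewrite /p6; ring.
have [t2 t3] : 0 < t ^+ 2 /\ 0 < t ^+ 3 by split; rewrite exprn_gt0.
by rewrite !mulr_gt0 //; lra.
Qed.

(** As t6 is a critical point, (t - t6) ^ 2 divides p6 t6 - p6 t; the quotient is a
    cubic in t whose coefficients are nonnegative because t6 > 4 / 5. *)
Lemma p6_max (R : realType) (t : R) : 0 < t -> p6 t <= p6 (t6 R).
Proof.
move=> t0; have [/andP[r45 r1]] := t6_spec R; move: (t6 R) r45 r1 => r r45 r1 hr.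
rewrite -subr_ge0.
have -> : p6 r - p6 t = (t - r) ^+ 2 *
    (20 * t ^+ 3 + (40 * r - 9) * t ^+ 2 + (60 * r ^+ 2 - 18 * r - 8) * t
     + (80 * r ^+ 3 - 27 * r ^+ 2 - 16 * r - 7))
    + 2 * (t - r) * (50 * r ^+ 4 - 18 * r ^+ 3 - 12 * r ^+ 2 - 7 * r - 3).
  by rewrite /p6; ring.
have c1 : 0 <= 60 * r ^+ 2 - 18 * r - 8 by nra.
have c0 : 0 <= 80 * r ^+ 3 - 27 * r ^+ 2 - 16 * r - 7.
  have -> : 80 * r ^+ 3 - 27 * r ^+ 2 - 16 * r - 7 =
    (r - 4 / 5) * (80 * r ^+ 2 + 37 * r + 68 / 5) + 97 / 25 by field.
  by rewrite addr_ge0 ?mulr_ge0 //; nra.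
rewrite hr mulr0 addr0; apply: mulr_ge0; first exact: sqr_ge0.
apply: addr_ge0 => //; apply: addr_ge0; last by rewrite mulr_ge0 // ltW.
by apply: addr_ge0; rewrite mulr_ge0 ?exprn_ge0 ?ltW //; lra.
Qed.

(** * The inequality at points with five equal variables *)

Lemma one_minus_prod (R : realType) (u : R) :
  1 - 6 ^+ 6 * ((u / 6) ^+ 5 * (1 - 5 * (u / 6))) =
  (1 - u) ^+ 2 * (1 + 2 * u + 3 * u ^+ 2 + 4 * u ^+ 3 + 5 * u ^+ 4).
Proof. by field. Qed.

(** Both 1 - 6 ^ 6 * P and 1 - 6 ^ 4 * P * S vanish doubly at u = 1, where all
    variables are equal; their cofactors are related by
    p6 u - 5 = u (6 - 5 u) (1 + 2 u + 3 u ^ 2 + 4 u ^ 3), and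
    S = 36 (5 - 4 u) / (u (6 - 5 u)). *)
Lemma gap_equal_variables (R : realType) (lam u : R)
    (t := u / 6) (z := 1 - 5 * (u / 6)) : u != 0 -> 6 - 5 * u != 0 ->
  (5 / t + 1 / z) * (1 + 6 ^+ 4 * (lam - 36) * (t ^+ 5 * z)) - lam =
  (1 - u) ^+ 2 / (u * (6 - 5 * u)) * (36 * p6 u - lam * (p6 u - 5)).
Proof.
move=> u0 u6; rewrite /z /t /p6; field.
by rewrite u0 u6.
Qed.

Lemma lambda6E (R : realType) :
  lambda6 R * (p6 (t6 R) - 5) = 36 * p6 (t6 R).
Proof.
have [/andP[r45 r1] _] := t6_spec R.
have M5 : 5 < p6 (t6 R) by apply: p6_gt5; lra.
rewrite /lambda6; field; rewrite !gt_eqF //; lra.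
Qed.

(** * The best constant *)

Theorem mainTheorem4 (R : realType) :
  admissible (lambda6 R) /\
  (forall lam : R, admissible lam -> lam <= lambda6 R).
Proof.
have [/andP[r45 r1] _] := t6_spec R; have lamE := lambda6E R.
have M5 : 5 < p6 (t6 R) by apply: p6_gt5; lra.
split.
- have lam36 : 36 < lambda6 R.
    rewrite -(@ltr_pM2r _ (p6 (t6 R) - 5)) ?subr_gt0 // lamE; lra.
  split=> [|x x0 x1]; first lra.
  have [t [z [t0 tz sE pE le_inv]]] := equal_variables R 5 x x0.
  rewrite -pE; set D := 1 + _.
  have z0 : 0 < z by exact: lt_le_trans tz.
  have D0 : 0 < D.
    by rewrite ltr_pwDl // !mulr_ge0 ?exprn_ge0 ?subr_ge0 ?ltW.
  rewrite ler_pdivrMr //; apply: le_trans (_ : (5 / t + 1 / z) * D <= _); last first.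
    by rewrite ler_pM2r.
  have [tE zE] : t = 6 * t / 6 /\ z = 1 - 5 * (6 * t / 6).
    by move: sE; rewrite x1 => sE; split; lra.
  have u0 : 0 < 6 * t by lra.
  have u1 : 0 < 6 - 5 * (6 * t) by move: z0; rewrite zE; lra.
  have := gap_equal_variables _ (lambda6 R) (6 * t).
  rewrite /= -zE -tE -/D !gt_eqF // => /(_ isT isT) gap.
  rewrite -subr_ge0 gap.
  have p5 : 5 < p6 (6 * t) by apply: p6_gt5; lra.
  have pM := p6_max _ _ u0.
  apply: mulr_ge0; first by rewrite divr_ge0 ?sqr_ge0 // ltW // mulr_gt0.
  (* By [lambda6E] the factor 36 * p - lambda6 * (p - 5) vanishes at p = p6 t6. *)
  have -> : 36 * p6 (6 * t) - lambda6 R * (p6 (6 * t) - 5) =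
      (lambda6 R - 36) * (p6 (t6 R) - p6 (6 * t)).
    have : lambda6 R * (p6 (t6 R) - 5) - 36 * p6 (t6 R) = 0 by rewrite lamE subrr.
    by move=> e; rewrite -[RHS]subr0 -e; ring.
  by rewrite mulr_ge0 // subr_ge0 // ltW.
- move=> lam [lam0].
  move=> /(_ (fun i => if i == ord0 then 1 - 5 * (t6 R / 6) else t6 R / 6)).
  set t := t6 R / 6; set z := 1 - 5 * t.
  have t0 : 0 < t by rewrite /t; lra.
  have z0 : 0 < z by rewrite /z /t; lra.
  have -> : \sum_(i < 6) (if i == ord0 then z else t) = 1.
    by rewrite !big_ord_recl big_ord0 /= /z; ring.
  have -> : \sum_(i < 6) (1 / (if i == ord0 then z else t)) = 5 / t + 1 / z.
    by rewrite !big_ord_recl big_ord0 /=; ring.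
  have -> : \prod_(i < 6) (if i == ord0 then z else t) = t ^+ 5 * z.
    by rewrite !big_ord_recl big_ord0 /=; ring.
  set D := 1 + _; move=> /(_ _ erefl).
  have D0 : 0 < D.
    (* D is at least 1 - 6 ^ 6 * P, positive because t6 differs from 1. *)
    have -> : D = (1 - 6 ^+ 6 * (t ^+ 5 * z)) + 6 ^+ 4 * (lam * (t ^+ 5 * z)).
      by rewrite /D; ring.
    rewrite one_minus_prod.
    have r0 : 0 < t6 R by lra.
    have c0 : 0 < (1 - t6 R) ^+ 2 by rewrite exprn_gt0 // subr_gt0.
    have c1 : 0 <= lam * (t ^+ 5 * z).
      apply: mulr_ge0; first exact: ltW.
      by apply: mulr_ge0; [apply: exprn_ge0; exact: ltW | exact: ltW].
    have c2 : 0 < 1 + 2 * t6 R + 3 * t6 R ^+ 2 + 4 * t6 R ^+ 3 + 5 * t6 R ^+ 4.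
      by rewrite !addr_gt0 // mulr_gt0 // exprn_gt0.
    apply: ltr_wpDr; last exact: mulr_gt0.
    by apply: mulr_ge0 => //; apply: exprn_ge0.
  move=> adm; have {adm} : lam / D <= 5 / t + 1 / z by apply: adm => i; case: ifP.
  rewrite ler_pdivrMr // -subr_ge0 /D gap_equal_variables; first last.
  - by rewrite gt_eqF //; lra.
  - by rewrite gt_eqF //; lra.
  have c0 : 0 < (1 - t6 R) ^+ 2 / (t6 R * (6 - 5 * t6 R)).
    by apply: divr_gt0; [apply: exprn_gt0 | apply: mulr_gt0]; lra.
  by rewrite (pmulr_rge0 _ c0) subr_ge0 -lamE ler_pM2r // subr_gt0.
Qed.
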